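(* Let $\mathbb{T}$ be a time scale, let $a,b\in\mathbb{T}$ with $a<b$, let $f_n:[a,b]_{\mathbb{T}}\to\mathbb{R}_{\mathcal{F}}$, $n=1,2,\ldots$, be FHK $\Delta$-integrable on $[a,b]_{\mathbb{T}}$, and let $f:[a,b]_{\mathbb{T}}\to\mathbb{R}_{\mathcal{F}}$. Suppose that: (1) $\lim_{n\to\infty}f_n(x)=f(x)$ for every $x\in[a,b]_{\mathbb{T}}$; (2) the sequence $\{f_n\}$ is uniformly FHK $\Delta$-integrable on $[a,b]_{\mathbb{T}}$. Then $f$ is FHK $\Delta$-integrable on $[a,b]_{\mathbb{T}}$ and $$\lim_{n\to\infty}(FHK)\int_{[a,b]_{\mathbb{T}}}f_n(x)\Delta x=(FHK)\int_{[a,b]_{\mathbb{T}}}f(x)\Delta x.$$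
   Context: Fuzzy numbers: $\mathbb{R}_{\mathcal{F}}$ is the set of functions $u:\mathbb{R}\to[0,1]$ that are normal ($u(x_0)=1$ for some $x_0$), fuzzy convex ($u(\lambda x_1+(1-\lambda)x_2)\ge\min\{u(x_1),u(x_2)\}$ for all $x_1,x_2\in\mathbb{R}$, $\lambda\in(0,1)$), upper semicontinuous, and such that $[u]^0:=\overline{\{x:u(x)>0\}}$ is compact. For $\alpha\in(0,1]$, $[u]^\alpha:=\{x:u(x)\ge\alpha\}$; for each $\alpha\in[0,1]$ this is a compact interval, written $[u]^\alpha=[\underline{u^\alpha},\overline{u^\alpha}]$. Addition and real scalar multiplication are defined levelwise: $[u+v]^\alpha=[u]^\alpha+[v]^\alpha$, $[\lambda\odot u]^\alpha=\lambda[u]^\alpha$ for all $\alpha\in[0,1]$. The metric is $\mathbf{D}(u,v)=\sup_{\alpha\in[0,1]}\max\{|\underline{u^\alpha}-\underline{v^\alpha}|,|\overline{u^\alpha}-\overline{v^\alpha}|\}$. Limits in $\mathbb{R}_{\mathcal{F}}$ are with respect to $\mathbf{D}$. Time scales: a time scale $\mathbb{T}$ is a nonempty closed subset of $\mathbb{R}$; $[a,b]_{\mathbb{T}}=\{x\in\mathbb{T}:a\le x\le b\}$, and similarly for other intervals. $\sigma(x)=\inf\{y\in\mathbb{T}:y>x\}$ (with $\sigma(\sup\mathbb{T})=\sup\mathbb{T}$ if finite), $\mu(x)=\sigma(x)-x$. A $\Delta$-gauge on $[a,b]_{\mathbb{T}}$ is a pair $\delta=(\delta_L,\delta_R)$ of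 real functions on $[a,b]_{\mathbb{T}}$ with $\delta_L>0$ on $(a,b]_{\mathbb{T}}$, $\delta_R>0$ on $[a,b)_{\mathbb{T}}$, $\delta_L(a)\ge0$, $\delta_R(b)\ge0$, and $\delta_R(\xi)\ge\mu(\xi)$ for all $\xi\in[a,b)_{\mathbb{T}}$. A $\delta$-fine HK division of $[a,b]_{\mathbb{T}}$ is a finite collection $D=\{([x_{i-1},x_i]_{\mathbb{T}},\xi_i)\}_{i=1}^n$ with $a=x_0<x_1<\dots<x_n=b$ points of $\mathbb{T}$, $\xi_i\in[x_{i-1},x_i]_{\mathbb{T}}$, and $\xi_i-\delta_L(\xi_i)\le x_{i-1}<x_i\le\xi_i+\delta_R(\xi_i)$ for each $i$. Write $\Delta x_i=x_i-x_{i-1}$ and $S(f,D,\delta)=\sum_{i=1}^n f(\xi_i)\Delta x_i$. FHK $\Delta$-integrability: $f:[a,b]_{\mathbb{T}}\to\mathbb{R}_{\mathcal{F}}$ is FHK $\Delta$-integrable on $[a,b]_{\mathbb{T}}$ with integral $\tilde A=(FHK)\int_{[a,b]_{\mathbb{T}}}f(x)\Delta x\in\mathbb{R}_{\mathcal{F}}$ if for each $\epsilon>0$ there is a $\Delta$-gauge $\delta$ on $[a,b]_{\mathbb{T}}$ with $\mathbf{D}(S(f,D,\delta),\tilde A)<\epsilon$ for every $\delta$-fine HK division $D$ of $[a,b]_{\mathbb{T}}$. Uniform integrability: a sequence $\{f_n\}$ of FHK $\Delta$-integrable functions on $[a,b]_{\mathbb{T}}$ is uniformly FHK $\Delta$-integrable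 on $[a,b]_{\mathbb{T}}$ if for each $\epsilon>0$ there is a $\Delta$-gauge $\delta$ on $[a,b]_{\mathbb{T}}$ such that $\mathbf{D}\left(S(f_n,D,\delta),(FHK)\int_{[a,b]_{\mathbb{T}}}f_n(x)\Delta x\right)<\epsilon$ for every $\delta$-fine HK division $D$ of $[a,b]_{\mathbb{T}}$ and every $n$. *)

(* Defs.v *)
From HB Require Import structures.
From mathcomp Require Import all_boot all_order all_algebra.
From mathcomp Require Import all_classical all_reals all_analysis.
From mathcomp Require Import lra.
Set Implicit Arguments.
Unset Strict Implicit.
Unset Printing Implicit Defensive.
Import Order.TTheory GRing.Theory Num.Theory numFieldNormedType.Exports.
Local Open Scope classical_set_scope.
Local Open Scope ring_scope.

Record fuzzy (R : realType) := Fuzzy {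
  memb :> R -> R;
  memb01 : forall x, 0 <= memb x <= 1;
  fuzzy_normal : exists x0, memb x0 = 1;
  fuzzy_convex : forall x1 x2 l, 0 < l < 1 ->
    Num.min (memb x1) (memb x2) <= memb (l * x1 + (1 - l) * x2);
  fuzzy_usc : forall x c, memb x < c -> \forall y \near x, memb y < c;
  fuzzy_compact : compact (closure [set x | 0 < memb x]) }.
Arguments memb01 {R} f x.
Arguments fuzzy_normal {R} f.
Arguments fuzzy_convex {R} f x1 x2 {l}.
Arguments fuzzy_usc {R} f {x c}.
Arguments fuzzy_compact {R} f.

Definition level (R : realType) (u : fuzzy R) (alpha : R) : set R :=
  if alpha == 0 then closure [set x | 0 < u x] else [set x | alpha <= u x].

(* End points of the level sets; see [levelE]. *)
Definition lo (R : realType) (u : fuzzy R) (alpha : R) : R := inf (level u alpha).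
Definition hi (R : realType) (u : fuzzy R) (alpha : R) : R := sup (level u alpha).

Section level_theory.
Context {R : realType}.
Implicit Types (u v w : fuzzy R) (a b x y z : R).

Lemma level_pos u a : 0 < a -> level u a = [set x | a <= u x].
Proof. by move=> a0; rewrite /level gt_eqF. Qed.

Lemma level_sub u a b : 0 <= a -> a <= b -> level u b `<=` level u a.
Proof.
move=> a0 ab x; rewrite /level; case: eqP => [b0|/eqP bn0].
  have -> : a = 0 by apply/le_anti/andP; split=> //; rewrite -b0.
  by rewrite eqxx.
have b0 : 0 < b by rewrite lt_neqAle eq_sym bn0 (le_trans a0).
move=> /= bx; case: eqP => _ /=; last exact: le_trans bx.
by apply: subset_closure => /=; apply: lt_le_trans bx.
Qed.

Lemma level_closed u a : closed (level u a).
Proof.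
rewrite /level; case: eqP => _; first exact: closed_closure.
rewrite -[X in closed X]setCK; apply: open_closedC.
rewrite openE => x /= /negP; rewrite -ltNge => xa.
rewrite /interior; have := fuzzy_usc u xa; apply: filterS => y ya /=.
by apply/negP; rewrite -ltNge.
Qed.

Lemma level_neq0 u a : a <= 1 -> level u a !=set0.
Proof.
move=> a1; have [x0 ux0] := fuzzy_normal u; exists x0; rewrite /level.
case: eqP => _ /=; last by rewrite ux0.
by apply: subset_closure => /=; rewrite ux0.
Qed.

Lemma level_bounded u : exists M, forall a x, 0 <= a -> level u a x -> `|x| <= M.
Proof.
have [M [_ hM]] := compact_bounded (fuzzy_compact u).
exists (M + 1) => a x a0 /(level_sub (lexx 0) a0); rewrite /level eqxx => ux.
by apply: (hM (M + 1) _ x ux); rewrite ltrDl.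
Qed.

Lemma level_has_ubound u a : 0 <= a -> has_ubound (level u a).
Proof.
by move=> a0; have [M hM] := level_bounded u; exists M => x /(hM _ _ a0);
  rewrite ler_norml => /andP[].
Qed.

Lemma level_has_lbound u a : 0 <= a -> has_lbound (level u a).
Proof.
by move=> a0; have [M hM] := level_bounded u; exists (- M) => x /(hM _ _ a0);
  rewrite ler_norml => /andP[].
Qed.

Lemma level_hi u a : 0 <= a <= 1 -> level u a (hi u a).
Proof.
move=> /andP[a0 a1]; rewrite (closure_id (level u a)).1; last exact: level_closed.
by apply: closure_sup; [exact: level_neq0|exact: level_has_ubound].
Qed.

Lemma level_lo u a : 0 <= a <= 1 -> level u a (lo u a).
Proof.
move=> /andP[a0 a1]; rewrite (closure_id (level u a)).1; last exact: level_closed.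
have hinf : has_inf (level u a).
  by split; [exact: level_neq0|exact: level_has_lbound].
move=> B /nbhs_ballP[e /= e0 eB]; have [x ux xe] := inf_adherent e0 hinf.
exists x; split=> //; apply: eB; rewrite /ball /= ltr_distlC.
have := ge_inf (level_has_lbound u a0) ux; rewrite -/(lo u a) => lox.
by rewrite xe (lt_le_trans _ lox)// ltrBlDr ltrDl.
Qed.

Lemma lo_ge u a x : 0 <= a -> level u a x -> lo u a <= x.
Proof. by move=> a0 ux; apply: ge_inf => //; exact: level_has_lbound. Qed.

Lemma hi_le u a x : 0 <= a -> level u a x -> x <= hi u a.
Proof. by move=> a0 ux; apply: ub_le_sup => //; exact: level_has_ubound. Qed.

Lemma lo_le_hi u a : 0 <= a <= 1 -> lo u a <= hi u a.
Proof. by move=> a01; apply: lo_ge (level_hi _ _) => //; case/andP: a01. Qed.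

Lemma lo_mono u a b : 0 <= a -> a <= b -> b <= 1 -> lo u a <= lo u b.
Proof.
move=> a0 ab b1; apply: lo_ge => //; apply: (level_sub a0 ab).
by apply: level_lo; rewrite b1 (le_trans a0).
Qed.

Lemma hi_mono u a b : 0 <= a -> a <= b -> b <= 1 -> hi u b <= hi u a.
Proof.
move=> a0 ab b1; apply: hi_le => //; apply: (level_sub a0 ab).
by apply: level_hi; rewrite b1 (le_trans a0).
Qed.

Lemma level_itv_pos u a x : 0 < a <= 1 -> lo u a <= x <= hi u a -> a <= u x.
Proof.
move=> /andP[a0 a1] /andP[lx xh].
have a01 : 0 <= a <= 1 by rewrite ltW.
have := level_lo u a01; have := level_hi u a01.
rewrite level_pos//= => uh ul.
have [<-//|lnx] := eqVneq (lo u a) x; have [->//|xnh] := eqVneq x (hi u a).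
have lx' : lo u a < x by rewrite lt_neqAle lnx.
have xh' : x < hi u a by rewrite lt_neqAle xnh.
have lh : 0 < hi u a - lo u a by rewrite subr_gt0 (lt_trans lx').
pose l := (hi u a - x) / (hi u a - lo u a).
have l01 : 0 < l < 1.
  rewrite /l ltr_pdivrMr// mul1r ltrD2l ltrN2 lx' andbT.
  by rewrite divr_gt0// subr_gt0.
have := fuzzy_convex u (lo u a) (hi u a) l01.
have -> : l * lo u a + (1 - l) * hi u a = x.
  have : l * (hi u a - lo u a) = hi u a - x by rewrite /l divfK// gt_eqF.
  by move=> e; lra.
by apply: le_trans; rewrite le_min ul uh.
Qed.

Lemma closure_near (A : set R) p e :
  closure A p -> 0 < e -> exists2 x, A x & `|p - x| < e.
Proof.
by move=> cA e0; have [x [Ax px]] := cA _ (nbhsx_ballx p e e0); exists x.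
Qed.

Lemma near_closure (A : set R) p :
  (forall e, 0 < e -> exists2 x, A x & `|p - x| < e) -> closure A p.
Proof.
by move=> h B /nbhs_ballP[e /= /h[x Ax px] eB]; exists x; split=> //; apply: eB.
Qed.

Lemma lo_leftC u a e : 0 < a <= 1 -> 0 < e ->
  exists2 b, 0 < b < a & lo u a - e < lo u b.
Proof.
move=> /andP[a0 a1] e0; apply/not_exists2P => h.
have a01 : 0 <= a <= 1 by rewrite ltW.
have : a <= u (lo u a - e).
  apply/ler_addgt0Pr => d d0; rewrite -lerBlDr.
  pose b := Num.max (a - d) (a / 2).
  have [b0 ba] : 0 < b /\ b < a.
    by split; rewrite ?lt_max ?gt_max ?divr_gt0 ?orbT//; apply/andP; split; lra.
  apply: (@le_trans _ _ b); first by rewrite le_max lexx.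
  apply: level_itv_pos; first by rewrite b0 (le_trans (ltW ba)).
  have [/negP|/negP] := h b; first by rewrite b0 ba.
  rewrite -leNgt => -> /=; apply: (@le_trans _ _ (lo u a)); first by lra.
  by rewrite (le_trans (lo_le_hi u a01))// hi_mono// ltW.
move=> ua; have : lo u a <= lo u a - e by apply: lo_ge; rewrite ?ltW ?level_pos.
by lra.
Qed.

Lemma hi_leftC u a e : 0 < a <= 1 -> 0 < e ->
  exists2 b, 0 < b < a & hi u b < hi u a + e.
Proof.
move=> /andP[a0 a1] e0; apply/not_exists2P => h.
have a01 : 0 <= a <= 1 by rewrite ltW.
have : a <= u (hi u a + e).
  apply/ler_addgt0Pr => d d0; rewrite -lerBlDr.
  pose b := Num.max (a - d) (a / 2).
  have [b0 ba] : 0 < b /\ b < a.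
    by split; rewrite ?lt_max ?gt_max ?divr_gt0 ?orbT//; apply/andP; split; lra.
  apply: (@le_trans _ _ b); first by rewrite le_max lexx.
  apply: level_itv_pos; first by rewrite b0 (le_trans (ltW ba)).
  have [/negP|/negP] := h b; first by rewrite b0 ba.
  rewrite -leNgt => -> /=; rewrite andbT; apply: (@le_trans _ _ (hi u a)); last by lra.
  by rewrite (le_trans _ (lo_le_hi u a01))// lo_mono// ltW.
move=> ua; have : hi u a + e <= hi u a by apply: hi_le; rewrite ?ltW ?level_pos.
by lra.
Qed.

Lemma lo_right0 u e : 0 < e -> exists2 b, 0 < b <= 1 & lo u b < lo u 0 + e.
Proof.
move=> e0; have := @level_lo u 0; rewrite lexx ler01 => /(_ isT).
rewrite {1}/level eqxx => /closure_near/(_ e0)[x /= ux]; rewrite ltr_distlC.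
move=> /andP[_ xe]; exists (u x); first by case/andP: (memb01 u x) => _ ->; rewrite ux.
by apply: le_lt_trans xe; apply: lo_ge; rewrite ?ltW ?level_pos /=.
Qed.

Lemma hi_right0 u e : 0 < e -> exists2 b, 0 < b <= 1 & hi u 0 - e < hi u b.
Proof.
move=> e0; have := @level_hi u 0; rewrite lexx ler01 => /(_ isT).
rewrite {1}/level eqxx => /closure_near/(_ e0)[x /= ux]; rewrite ltr_distlC.
move=> /andP[xe _]; exists (u x); first by case/andP: (memb01 u x) => _ ->; rewrite ux.
by apply: lt_le_trans xe _; apply: hi_le; rewrite ?ltW ?level_pos /=.
Qed.

End level_theory.

Section representation.
Context {R : realType} (l h : R -> R).
Hypothesis l_mono : forall a b : R, 0 <= a -> a <= b -> b <= 1 -> l a <= l b.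
Hypothesis h_mono : forall a b : R, 0 <= a -> a <= b -> b <= 1 -> h b <= h a.
Hypothesis lh1 : l 1 <= h 1.
Hypothesis l_leftC : forall a e : R, 0 < a <= 1 -> 0 < e ->
  exists2 b : R, 0 < b < a & l a - e < l b.
Hypothesis h_leftC : forall a e : R, 0 < a <= 1 -> 0 < e ->
  exists2 b : R, 0 < b < a & h b < h a + e.
Hypothesis l_right0 : forall e : R, 0 < e -> exists2 b : R, 0 < b <= 1 & l b < l 0 + e.
Hypothesis h_right0 : forall e : R, 0 < e -> exists2 b : R, 0 < b <= 1 & h 0 - e < h b.

Let G z : set R := [set a | a = 0 \/ (0 < a <= 1 /\ l a <= z <= h a)].
Let w z : R := sup (G z).

Let G01 z a : G z a -> 0 <= a <= 1.
Proof. by move=> /= [->|[/andP[/ltW -> ->]]]; rewrite ?lexx ?ler01. Qed.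

Let has_supG z : has_sup (G z).
Proof.
by split; [exists 0; left|exists 1 => a /G01/andP[]].
Qed.

Let w01 z : 0 <= w z <= 1.
Proof.
apply/andP; split; first by apply: ub_le_sup; [exact: (has_supG z).2|left].
by apply: ge_sup; [exists 0; left|move=> a /G01/andP[]].
Qed.

Let le_w (a z : R) : 0 < a <= 1 -> (a <= w z) = (l a <= z <= h a).
Proof.
move=> a01; have /andP[a0 a1] := a01; apply/idP/idP => [aw|lzh]; last first.
  by apply: ub_le_sup; [exact: (has_supG z).2|right].
have itvb b : 0 < b < a -> l b <= z <= h b.
  move=> /andP[b0 ba]; have bw : 0 < w z - b by rewrite subr_gt0 (lt_le_trans ba).
  have [c Gc] := sup_adherent bw (has_supG z).
  rewrite -/(w z) opprB addrC subrK => bc.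
  case: Gc => [c0|[/andP[c0 c1] /andP[lz zh]]]; first by move: bc; rewrite c0 ltNge ltW.
  by rewrite (le_trans _ lz) ?(le_trans zh)// ?(l_mono,h_mono)// ltW.
apply/andP; split; rewrite leNgt; apply/negP => zl.
  have [b /itvb/andP[lb _] ltb] := l_leftC a01 (etrans (subr_gt0 _ _) zl).
  by move: ltb; rewrite opprB addrC subrK ltNge lb.
have [b /itvb/andP[_ hb] ltb] := h_leftC a01 (etrans (subr_gt0 _ _) zl).
by move: ltb; rewrite addrC subrK ltNge hb.
Qed.

Let l1h (a b : R) : 0 <= a <= 1 -> 0 <= b <= 1 -> l a <= h b.
Proof.
move=> /andP[a0 a1] /andP[b0 b1].
by rewrite (le_trans (l_mono a0 a1 _))// (le_trans lh1)// h_mono.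
Qed.

Let P11 : 0 < (1 : R) <= 1. Proof. by rewrite ltr01 lexx. Qed.

Let w_level0 : closure [set x | 0 < w x] = [set x | l 0 <= x <= h 0].
Proof.
apply/seteqP; split => [|z /= /andP[lz zh]].
  have -> : [set x | l 0 <= x <= h 0] = `[l 0, h 0]%classic.
    by apply/seteqP; split=> x; rewrite /= in_itv.
  rewrite (closure_id `[l 0, h 0]%classic).1; last exact: interval_closed.
  apply: closure_subset => x /= wx; rewrite in_itv /=.
  have wx1 : 0 < w x <= 1 by rewrite wx; case/andP: (w01 x).
  have := lexx (w x); rewrite le_w// => /andP[lx xh].
  by case/andP: wx1 => _ w1; rewrite (le_trans _ lx) ?(le_trans xh)// ?(l_mono,h_mono)// ltW.
apply: near_closure => e e0.
have wit b x : 0 < b <= 1 -> l b <= x <= h b -> 0 < w x.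
  by move=> b01 H; apply: lt_le_trans (_ : b <= _); [case/andP: b01|rewrite le_w].
have [l1z|zl1] := leP (l 1) z; last first.
  have [b b01 lb] := l_right0 e0; exists (Num.max z (l b)).
    have /andP[b0 b1] := b01; apply: (wit b) => //; rewrite le_max lexx orbT ge_max.
    have bI : 0 <= b <= 1 by rewrite ltW.
    by rewrite (l1h bI bI) andbT (le_trans (ltW zl1))// l1h// ler01 lexx.
  rewrite ltr_distlC gt_max lt_max; apply/andP; split; last by apply/andP; split; lra.
  by apply/orP; left; lra.
have [zh1|h1z] := leP z (h 1); first by exists z; [apply: (wit 1); rewrite ?l1z|rewrite subrr normr0].
have [b b01 hb] := h_right0 e0; exists (Num.min z (h b)).
  have /andP[b0 b1] := b01; apply: (wit b) => //; rewrite ge_min lexx orbT le_min.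
  have bI : 0 <= b <= 1 by rewrite ltW.
  by rewrite (l1h bI bI) !andbT (le_trans _ (ltW h1z))// l1h// ler01 lexx.
rewrite ltr_distlC lt_min gt_min; apply/andP; split; first by apply/andP; split; lra.
by apply/orP; left; lra.
Qed.

Let w_normal : exists x0, w x0 = 1.
Proof.
exists (l 1); apply/le_anti; have /andP[_ ->] := w01 (l 1).
by rewrite le_w ?lexx ?ltr01.
Qed.

Let w_convex x1 x2 t : 0 < t < 1 ->
  Num.min (w x1) (w x2) <= w (t * x1 + (1 - t) * x2).
Proof.
move=> /andP[t0 t1]; set m := Num.min _ _.
have [m0|m0] := leP m 0; first by apply: le_trans m0 _; case/andP: (w01 (t * x1 + (1 - t) * x2)).
have m01 : 0 < m <= 1 by rewrite m0 /m ge_min; case/andP: (w01 x1) => _ ->.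
have : m <= w x1 by rewrite /m ge_min lexx.
have : m <= w x2 by rewrite /m ge_min lexx orbT.
rewrite !le_w// => /andP[a2 b2] /andP[a1 b1].
apply/andP; split; nra.
Qed.

Let w_usc x c : w x < c -> \forall y \near x, w y < c.
Proof.
move=> wc; have [c1|c1] := leP c 1; last first.
  by apply: filterE => y; apply: le_lt_trans c1; case/andP: (w01 y).
have c01 : 0 < c <= 1 by rewrite c1 (le_lt_trans _ wc)//; case/andP: (w01 x).
have : open (~` `[l c, h c]%classic) by apply: closed_openC; exact: interval_closed.
rewrite openE => /(_ x); have hyp y : (~` `[l c, h c]%classic) y -> w y < c.
  by move=> /= /negP; rewrite in_itv /= -le_w// -ltNge.
move=> H; have : (~` `[l c, h c]%classic)^° x.
  by apply: H => /=; rewrite in_itv /= -le_w// leNgt wc.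
by rewrite /interior; apply: filterS => y /hyp.
Qed.

Let w_compact : compact (closure [set x | 0 < w x]).
Proof.
rewrite w_level0.
have -> : [set x | l 0 <= x <= h 0] = `[l 0, h 0]%classic.
  by apply/seteqP; split=> x; rewrite /= in_itv.
exact: segment_compact.
Qed.

Lemma fuzzy_representation : exists v : fuzzy R, forall a, 0 <= a <= 1 ->
  level v a = [set x | l a <= x <= h a].
Proof.
exists (Fuzzy w01 w_normal w_convex w_usc w_compact) => a /andP[a0 a1].
rewrite /level; case: eqP => [->|/eqP an0] /=; first exact: w_level0.
have aI : 0 < a <= 1 by rewrite a1 lt_neqAle eq_sym an0 a0.
by apply/seteqP; split=> x /=; rewrite (le_w _ aI).
Qed.

End representation.

Section fuzzy_ops.
Context {R : realType}.
Implicit Types u v : fuzzy R.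

Lemma levelE u a : 0 <= a <= 1 ->
  level u a = [set x | lo u a <= x <= hi u a].
Proof.
have [v Ev] := fuzzy_representation (@lo_mono _ u) (@hi_mono _ u)
  (lo_le_hi u (introT andP (conj ler01 (lexx 1)))) (@lo_leftC _ u)
  (@hi_leftC _ u) (@lo_right0 _ u) (@hi_right0 _ u).
have vuE x c : 0 < c -> (c <= v x) = (c <= u x).
  move=> c0; have [c1|c1] := leP c 1; last first.
    apply/idP/idP => /(lt_le_trans c1); rewrite ltNge.
      by case/andP: (memb01 v x) => _ ->.
    by case/andP: (memb01 u x) => _ ->.
  have c01 : 0 <= c <= 1 by rewrite ltW.
  have vE : [set x | c <= v x] = [set x | lo u c <= x <= hi u c].
    by rewrite -Ev// level_pos.
  apply/idP/idP => [cv|cu].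
    have : [set x | c <= v x] x by [].
    by rewrite vE; apply: level_itv_pos; rewrite c0.
  suff : [set x | c <= v x] x by [].
  by rewrite vE /= lo_ge ?hi_le ?ltW// level_pos.
move=> a01; rewrite -Ev// /level; case: eqP => an0.
  congr closure; apply/seteqP; split=> x /= x0.
    by rewrite (lt_le_trans x0)// vuE.
  by rewrite (lt_le_trans x0)// -vuE.
apply/seteqP; split=> x /=; rewrite vuE//; case/andP: a01;
  by rewrite le_eqVlt => /predU1P[/esym|].
Qed.

Lemma lo_hi_unique v a x y : 0 <= a <= 1 -> x <= y ->
  level v a = [set z | x <= z <= y] -> lo v a = x /\ hi v a = y.
Proof.
move=> a01 xy E; have a0 : 0 <= a by case/andP: a01.
have := level_lo v a01; have := level_hi v a01; rewrite E /= => /andP[xh hy] /andP[xl ly].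
split; apply/le_anti; rewrite ?xl ?hy /= ?andbT.
  by apply: lo_ge => //; rewrite E /= lexx.
by apply: hi_le => //; rewrite E /= lexx xy.
Qed.

Lemma fuzzy_ext u v :
  (forall a, 0 <= a <= 1 -> level u a = level v a) -> u = v.
Proof.
move=> E; have memE : memb u = memb v.
  have le12 (p q : fuzzy R) x : (forall a, 0 <= a <= 1 -> level p a = level q a) ->
      p x <= q x.
    move=> F; have /andP[p0 p1] := memb01 p x.
    have [p00|pn0] := eqVneq (p x) 0; first by rewrite p00; case/andP: (memb01 q x).
    have pp : 0 < p x by rewrite lt_neqAle eq_sym pn0.
    have : level p (p x) x by rewrite level_pos /=.
    by rewrite F ?p0// level_pos.
  by apply/funext => x; apply/le_anti; rewrite !le12// => a a01; rewrite E.
case: u v memE {E} => [u u1 u2 u3 u4 u5] [v v1 v2 v3 v4 v5] /= E.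
by subst v; congr Fuzzy; exact: Prop_irrelevance.
Qed.

Lemma fuzzy_ext_lohi u v :
  (forall a, 0 <= a <= 1 -> lo u a = lo v a /\ hi u a = hi v a) -> u = v.
Proof.
by move=> E; apply: fuzzy_ext => a a01; rewrite !levelE//; have [-> ->] := E _ a01.
Qed.

Lemma fadd_subproof u v : exists w : fuzzy R, forall a, 0 <= a <= 1 ->
  level w a = [set x + y | x in level u a & y in level v a].
Proof.
have [|||||||w Ew] := @fuzzy_representation R
    (fun a => lo u a + lo v a) (fun a => hi u a + hi v a).
- by move=> a b *; rewrite lerD// lo_mono.
- by move=> a b *; rewrite lerD// hi_mono.
- by rewrite lerD// lo_le_hi// ler01 lexx.
- move=> a e a01 e0; have e2 : 0 < e / 2 by rewrite divr_gt0.
  have [b /andP[b0 ba] ub] := lo_leftC u a01 e2.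
  have [c /andP[c0 ca] vc] := lo_leftC v a01 e2.
  exists (Num.max b c); first by rewrite lt_max b0 gt_max ba ca.
  have [a0 a1] := andP a01.
  have m1 : Num.max b c <= 1 by rewrite ge_max !(le_trans (ltW _) a1).
  have : lo u b <= lo u (Num.max b c) by rewrite lo_mono ?le_max ?lexx// ltW.
  have : lo v c <= lo v (Num.max b c) by rewrite lo_mono ?le_max ?lexx ?orbT// ltW.
  by lra.
- move=> a e a01 e0; have e2 : 0 < e / 2 by rewrite divr_gt0.
  have [b /andP[b0 ba] ub] := hi_leftC u a01 e2.
  have [c /andP[c0 ca] vc] := hi_leftC v a01 e2.
  exists (Num.max b c); first by rewrite lt_max b0 gt_max ba ca.
  have [a0 a1] := andP a01.
  have m1 : Num.max b c <= 1 by rewrite ge_max !(le_trans (ltW _) a1).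
  have : hi u (Num.max b c) <= hi u b by rewrite hi_mono ?le_max ?lexx// ltW.
  have : hi v (Num.max b c) <= hi v c by rewrite hi_mono ?le_max ?lexx ?orbT// ltW.
  by lra.
- move=> e e0; have e2 : 0 < e / 2 by rewrite divr_gt0.
  have [b /andP[b0 b1] ub] := lo_right0 u e2.
  have [c /andP[c0 c1] vc] := lo_right0 v e2.
  exists (Num.min b c); first by rewrite lt_min b0 c0 ge_min b1.
  have m0 : 0 <= Num.min b c by rewrite le_min !ltW.
  have : lo u (Num.min b c) <= lo u b by rewrite lo_mono ?ge_min ?lexx.
  have : lo v (Num.min b c) <= lo v c by rewrite lo_mono ?ge_min ?lexx ?orbT.
  by lra.
- move=> e e0; have e2 : 0 < e / 2 by rewrite divr_gt0.
  have [b /andP[b0 b1] ub] := hi_right0 u e2.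
  have [c /andP[c0 c1] vc] := hi_right0 v e2.
  exists (Num.min b c); first by rewrite lt_min b0 c0 ge_min b1.
  have m0 : 0 <= Num.min b c by rewrite le_min !ltW.
  have : hi u b <= hi u (Num.min b c) by rewrite hi_mono ?ge_min ?lexx.
  have : hi v c <= hi v (Num.min b c) by rewrite hi_mono ?ge_min ?lexx ?orbT.
  by lra.
exists w => a a01; rewrite Ew// !levelE//; have luh := lo_le_hi u a01.
have lvh := lo_le_hi v a01; apply/seteqP; split=> [z /= /andP[lz zh]|z /=]; last first.
  by move=> [x /andP[? ?]] [y /andP[? ?] <-]; apply/andP; split; lra.
have [zl|lz'] := leP z (lo u a + hi v a).
  exists (lo u a); first by rewrite lexx.
  by exists (z - lo u a); [apply/andP; split; lra|lra].
exists (z - hi v a); first by apply/andP; split; lra.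
by exists (hi v a); [rewrite lvh lexx|lra].
Qed.

(* The fuzzy number with [u + v]^alpha = [u]^alpha + [v]^alpha. *)
Definition fadd u v : fuzzy R := projT1 (cid (fadd_subproof u v)).

Lemma level_fadd u v a : 0 <= a <= 1 ->
  level (fadd u v) a = [set x + y | x in level u a & y in level v a].
Proof. exact: (projT2 (cid (fadd_subproof u v))). Qed.

Lemma fscale_subproof (k : R) u : exists w : fuzzy R, forall a, 0 <= a <= 1 ->
  level w a = [set k * x | x in level u a].
Proof.
have [k0|k0|->] := ltgtP k 0.
- have nk : 0 < - k by lra.
  have dk e : 0 < e -> 0 < e / (- k) by move=> e0; rewrite divr_gt0.
  have mk e : e / (- k) * (- k) = e by rewrite divfK// gt_eqF.
  have [|||||||w Ew] := @fuzzy_representation R (fun a => k * hi u a) (fun a => k * lo u a).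
  + by move=> a b *; rewrite ler_nM2l// hi_mono.
  + by move=> a b *; rewrite ler_nM2l// lo_mono.
  + by rewrite ler_nM2l// lo_le_hi// ler01 lexx.
  + move=> a e a01 e0; have [b ba H] := hi_leftC u a01 (dk _ e0); exists b => //.
    by move: H (mk e); nra.
  + move=> a e a01 e0; have [b ba H] := lo_leftC u a01 (dk _ e0); exists b => //.
    by move: H (mk e); nra.
  + move=> e e0; have [b ba H] := hi_right0 u (dk _ e0); exists b => //.
    by move: H (mk e); nra.
  + move=> e e0; have [b ba H] := lo_right0 u (dk _ e0); exists b => //.
    by move: H (mk e); nra.
  exists w => a a01; rewrite Ew// levelE//.
  apply/seteqP; split=> [z /= /andP[? ?]|z /= [x /andP[? ?] <-]].
    have E : k * (z / k) = z by rewrite mulrC divfK// lt_eqF.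
    by exists (z / k) => //; apply/andP; split; rewrite -(ler_nM2l k0) E.
  by rewrite !ler_nM2l//; apply/andP.
- have dk e : 0 < e -> 0 < e / k by move=> e0; rewrite divr_gt0.
  have mk e : e / k * k = e by rewrite divfK// gt_eqF.
  have [|||||||w Ew] := @fuzzy_representation R (fun a => k * lo u a) (fun a => k * hi u a).
  + by move=> a b *; rewrite ler_pM2l// lo_mono.
  + by move=> a b *; rewrite ler_pM2l// hi_mono.
  + by rewrite ler_pM2l// lo_le_hi// ler01 lexx.
  + move=> a e a01 e0; have [b ba H] := lo_leftC u a01 (dk _ e0); exists b => //.
    by move: H (mk e); nra.
  + move=> a e a01 e0; have [b ba H] := hi_leftC u a01 (dk _ e0); exists b => //.
    by move: H (mk e); nra.
  + move=> e e0; have [b ba H] := lo_right0 u (dk _ e0); exists b => //.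
    by move: H (mk e); nra.
  + move=> e e0; have [b ba H] := hi_right0 u (dk _ e0); exists b => //.
    by move: H (mk e); nra.
  exists w => a a01; rewrite Ew// levelE//.
  apply/seteqP; split=> [z /= /andP[? ?]|z /= [x /andP[? ?] <-]].
    have E : k * (z / k) = z by rewrite mulrC divfK// gt_eqF.
    by exists (z / k) => //; apply/andP; split; rewrite -(ler_pM2l k0) E.
  by rewrite !ler_pM2l//; apply/andP.
- have [|||||||w Ew] := @fuzzy_representation R (fun=> 0) (fun=> 0) => //.
  + by move=> a e /andP[a0 _] e0; exists (a / 2); [apply/andP; split|]; lra.
  + by move=> a e /andP[a0 _] e0; exists (a / 2); [apply/andP; split|]; lra.
  + by move=> e e0; exists 1; rewrite ?ltr01 ?lexx//; lra.
  + by move=> e e0; exists 1; rewrite ?ltr01 ?lexx//; lra.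
  exists w => a a01; rewrite Ew//.
  apply/seteqP; split=> [z /= /le_anti <-|z /= [x _ <-]].
    by exists (lo u a); [exact: level_lo|rewrite mul0r].
  by rewrite mul0r lexx.
Qed.

(* The fuzzy number with [k u]^alpha = k [u]^alpha. *)
Definition fscale (k : R) u : fuzzy R := projT1 (cid (fscale_subproof k u)).

Lemma level_fscale (k : R) u a : 0 <= a <= 1 ->
  level (fscale k u) a = [set k * x | x in level u a].
Proof. exact: (projT2 (cid (fscale_subproof k u))). Qed.

Lemma fzero_subproof : exists w : fuzzy R, forall a, 0 <= a <= 1 ->
  level w a = [set 0].
Proof.
have [|||||||w Ew] := @fuzzy_representation R (fun=> 0) (fun=> 0) => //.
- by move=> a e /andP[a0 _] e0; exists (a / 2); [apply/andP; split|]; lra.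
- by move=> a e /andP[a0 _] e0; exists (a / 2); [apply/andP; split|]; lra.
- by move=> e e0; exists 1; rewrite ?ltr01 ?lexx//; lra.
- by move=> e e0; exists 1; rewrite ?ltr01 ?lexx//; lra.
exists w => a a01; rewrite Ew//.
by apply/seteqP; split=> [z /= /le_anti <-|z /= ->]; rewrite ?lexx.
Qed.

Definition fzero : fuzzy R := projT1 (cid fzero_subproof).

Lemma level_fzero a : 0 <= a <= 1 -> level fzero a = [set 0].
Proof. exact: (projT2 (cid fzero_subproof)). Qed.

Lemma faddA : associative fadd.
Proof.
move=> u v w; apply: fuzzy_ext => a a01; rewrite !level_fadd//.
apply/seteqP; split=> t /=.
  move=> [x ux [_ [y vy [z wz <-]] <-]]; exists (x + y); first by exists x => //; exists y.
  by exists z; rewrite // addrA.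
move=> [_ [x ux [y vy <-]] [z wz <-]]; exists x => //.
by exists (y + z); [exists y => //; exists z|rewrite addrA].
Qed.

Lemma faddC : commutative fadd.
Proof.
move=> u v; apply: fuzzy_ext => a a01; rewrite !level_fadd//.
apply/seteqP; split=> t /= [x ux [y vy <-]]; exists y => //; exists x => //; exact: addrC.
Qed.

Lemma fadd0 : left_id fzero fadd.
Proof.
move=> u; apply: fuzzy_ext => a a01; rewrite level_fadd// level_fzero//.
apply/seteqP; split=> [z /= [t -> [y uy <-]]|x ux /=]; first by rewrite add0r.
by exists 0 => //; exists x; rewrite // add0r.
Qed.

End fuzzy_ops.

HB.instance Definition _ (R : realType) := gen_eqMixin (fuzzy R).
HB.instance Definition _ (R : realType) := gen_choiceMixin (fuzzy R).
HB.instance Definition _ (R : realType) :=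
  GRing.isNmodule.Build (fuzzy R) (@faddA R) (@faddC R) (@fadd0 R).

(* The set is bounded ([fdist_has_sup]), so this is the true supremum. *)
Definition fdist (R : realType) (u v : fuzzy R) : R :=
  sup [set Num.max `|lo u alpha - lo v alpha| `|hi u alpha - hi v alpha|
      | alpha in [set alpha : R | 0 <= alpha <= 1]].

Lemma fdist_has_sup (R : realType) (u v : fuzzy R) :
  has_sup [set Num.max `|lo u alpha - lo v alpha| `|hi u alpha - hi v alpha|
          | alpha in [set alpha : R | 0 <= alpha <= 1]].
Proof.
split; first by eexists; exists 0 => //=; rewrite lexx ler01.
have [M hM] := level_bounded u; have [N hN] := level_bounded v.
exists (M + N) => _ [a /= a01 <-]; have a0 : 0 <= a by case/andP: a01.
rewrite ge_max; apply/andP; split; apply: le_trans (ler_normB _ _) _; apply: lerD.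
- by apply: (hM a) => //; exact: level_lo.
- by apply: (hN a) => //; exact: level_lo.
- by apply: (hM a) => //; exact: level_hi.
- by apply: (hN a) => //; exact: level_hi.
Qed.

Definition fcvg (R : realType) (u : nat -> fuzzy R) (l : fuzzy R) : Prop :=
  fdist (u n) l @[n --> \oo] --> (0 : R).

Definition time_scale (R : realType) (T : set R) : Prop := T !=set0 /\ closed T.

Definition ts_itv (R : realType) (T : set R) (a b : R) : set R :=
  [set x | T x /\ a <= x <= b].

Definition ts_sigma (R : realType) (T : set R) (x : R) : R :=
  let A := [set y | T y /\ x < y] in if A == set0 then sup T else inf A.

Definition ts_mu (R : realType) (T : set R) (x : R) : R := ts_sigma T x - x.

(* A gauge is the pair (dL, dR); only the values on [a, b]_T matter. *)
Definition gauge (R : realType) (T : set R) (a b : R)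
    (d : (R -> R) * (R -> R)) : Prop :=
  [/\ forall x, T x -> a < x <= b -> 0 < d.1 x,
      forall x, T x -> a <= x < b -> 0 < d.2 x,
      0 <= d.1 a,
      0 <= d.2 b
    & forall x, T x -> a <= x < b -> ts_mu T x <= d.2 x].

(* [pt 0 < ... < pt size] are the division points, and [tag i] is the tag of
   [pt i, pt i.+1]_T for [i < size]; other values of [pt], [tag] are unused. *)
Record division (R : realType) := Division {
  dsize : nat;
  pt : nat -> R;
  tag : nat -> R }.

Definition fine_division (R : realType) (T : set R) (a b : R)
    (d : (R -> R) * (R -> R)) (D : division R) : Prop :=
  [/\ pt D 0 = a, pt D (dsize D) = b,
      forall i, (i <= dsize D)%N -> T (pt D i)
    & forall i, (i < dsize D)%N ->
      [/\ pt D i < pt D i.+1,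
          ts_itv T (pt D i) (pt D i.+1) (tag D i),
          tag D i - d.1 (tag D i) <= pt D i
        & pt D i.+1 <= tag D i + d.2 (tag D i)]].

Definition riemann_sum (R : realType) (f : R -> fuzzy R) (D : division R) : fuzzy R :=
  \sum_(i < dsize D) fscale (pt D i.+1 - pt D i) (f (tag D i)).

(* A function on [a, b]_T is the restriction of [f : R -> fuzzy R]; values
   outside [a, b]_T play no role. *)
Definition is_FHK (R : realType) (T : set R) (a b : R) (f : R -> fuzzy R)
    (A : fuzzy R) : Prop :=
  forall e : R, 0 < e -> exists2 d, gauge T a b d &
    forall D, fine_division T a b d D -> fdist (riemann_sum f D) A < e.

Definition FHK_integrable (R : realType) (T : set R) (a b : R)
    (f : R -> fuzzy R) : Prop :=
  exists A, is_FHK T a b f A.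

(* The integral of [f], and the junk value 0 if [f] is not integrable. *)
Definition FHK_int (R : realType) (T : set R) (a b : R) (f : R -> fuzzy R) : fuzzy R :=
  xget 0 [set A | is_FHK T a b f A].

Definition uniformly_FHK (R : realType) (T : set R) (a b : R)
    (F : nat -> R -> fuzzy R) : Prop :=
  (forall n, FHK_integrable T a b (F n)) /\
  forall e : R, 0 < e -> exists2 d, gauge T a b d &
    forall D n, fine_division T a b d D ->
      fdist (riemann_sum (F n) D) (FHK_int T a b (F n)) < e.

(* Main.v *)
(** A gauge that works uniformly in [n] lets a single fine division (which
    exists by Cousin's lemma on time scales) approximate all the integrals of
    [F n] at once. Its Riemann sums are finite combinations of values of [F n],
    so they converge to that of [f]; hence the integrals form a Cauchy sequence,
    which converges because fuzzy numbers are complete. Letting [n] tend to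
    infinity in the uniform estimate shows that the limit is the integral of
    [f]. *)

Require Import Defs.
From mathcomp Require Import all_boot all_order all_algebra.
From mathcomp Require Import all_classical all_reals all_analysis.
From mathcomp Require Import lra.
Set Implicit Arguments.
Unset Strict Implicit.
Unset Printing Implicit Defensive.
Import Order.TTheory GRing.Theory Num.Theory numFieldNormedType.Exports.
Local Open Scope classical_set_scope.
Local Open Scope ring_scope.

(** * End points, metric and completeness of fuzzy numbers *)

Section fuzzy_metric.
Context {R : realType}.
Implicit Types (u v w : fuzzy R) (a e k : R).

Lemma lo_fadd u v a : 0 <= a <= 1 -> lo (fadd u v) a = lo u a + lo v a.
Proof.
move=> a01; have a0 : 0 <= a by case/andP: a01.
apply/le_anti/andP; split.
  apply: lo_ge => //; rewrite level_fadd//.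
  by exists (lo u a); [exact: level_lo|exists (lo v a); first exact: level_lo].
have := level_lo (fadd u v) a01; rewrite level_fadd// => -[x ux [y vy <-]].
by rewrite lerD// lo_ge.
Qed.

Lemma hi_fadd u v a : 0 <= a <= 1 -> hi (fadd u v) a = hi u a + hi v a.
Proof.
move=> a01; have a0 : 0 <= a by case/andP: a01.
apply/le_anti/andP; split.
  have := level_hi (fadd u v) a01; rewrite level_fadd// => -[x ux [y vy <-]].
  by rewrite lerD// hi_le.
apply: hi_le => //; rewrite level_fadd//.
by exists (hi u a); [exact: level_hi|exists (hi v a); first exact: level_hi].
Qed.

(** A negative factor would swap the two ends; the factors in a Riemann sum are lengths of
    intervals, hence nonnegative. *)
Lemma lo_fscale k u a : 0 <= k -> 0 <= a <= 1 -> lo (fscale k u) a = k * lo u a.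
Proof.
move=> k0 a01; have a0 : 0 <= a by case/andP: a01.
apply/le_anti/andP; split.
  apply: lo_ge => //; rewrite level_fscale//.
  by exists (lo u a); first exact: level_lo.
have := level_lo (fscale k u) a01; rewrite level_fscale// => -[x ux <-].
by rewrite ler_wpM2l// lo_ge.
Qed.

Lemma hi_fscale k u a : 0 <= k -> 0 <= a <= 1 -> hi (fscale k u) a = k * hi u a.
Proof.
move=> k0 a01; have a0 : 0 <= a by case/andP: a01.
apply/le_anti/andP; split.
  have := level_hi (fscale k u) a01; rewrite level_fscale// => -[x ux <-].
  by rewrite ler_wpM2l// hi_le.
apply: hi_le => //; rewrite level_fscale//.
by exists (hi u a); first exact: level_hi.
Qed.

Lemma lo_le_fdist u v a : 0 <= a <= 1 -> `|lo u a - lo v a| <= fdist u v.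
Proof.
move=> a01; apply: (@le_trans _ _ (Num.max `|lo u a - lo v a| `|hi u a - hi v a|)).
  by rewrite le_max lexx.
by apply: ub_le_sup; [exact: (fdist_has_sup u v).2|exists a].
Qed.

Lemma hi_le_fdist u v a : 0 <= a <= 1 -> `|hi u a - hi v a| <= fdist u v.
Proof.
move=> a01; apply: (@le_trans _ _ (Num.max `|lo u a - lo v a| `|hi u a - hi v a|)).
  by rewrite le_max lexx orbT.
by apply: ub_le_sup; [exact: (fdist_has_sup u v).2|exists a].
Qed.

Lemma fdist_le u v e :
  (forall a, 0 <= a <= 1 -> `|lo u a - lo v a| <= e) ->
  (forall a, 0 <= a <= 1 -> `|hi u a - hi v a| <= e) -> fdist u v <= e.
Proof.
move=> le_lo le_hi; apply: ge_sup; first exact: (fdist_has_sup u v).1.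
by move=> _ [a a01 <-]; rewrite ge_max le_lo// le_hi.
Qed.

Lemma fdist_ge0 u v : 0 <= fdist u v.
Proof. by apply: le_trans (@lo_le_fdist u v 0 _); rewrite ?lexx ?ler01. Qed.

Lemma fdistuu u : fdist u u = 0.
Proof.
by apply/le_anti; rewrite fdist_ge0 andbT; apply: fdist_le => a _; rewrite subrr normr0.
Qed.

Lemma fdistC u v : fdist u v = fdist v u.
Proof.
by apply/le_anti/andP; split; apply: fdist_le => a a01; rewrite distrC;
  rewrite ?lo_le_fdist ?hi_le_fdist.
Qed.

Lemma fdist_triangle v u w : fdist u w <= fdist u v + fdist v w.
Proof.
apply: fdist_le => a a01.
  by rewrite (le_trans (ler_distD (lo v a) _ _))// lerD// lo_le_fdist.
by rewrite (le_trans (ler_distD (hi v a) _ _))// lerD// hi_le_fdist.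
Qed.

Lemma fdist_eq0 u v : fdist u v <= 0 -> u = v.
Proof.
move=> uv; apply: fuzzy_ext_lohi => a a01; split; apply/eqP; rewrite -subr_eq0 -normr_le0.
  by rewrite (le_trans (lo_le_fdist _ _ a01)).
by rewrite (le_trans (hi_le_fdist _ _ a01)).
Qed.

Lemma fdist_fadd u v u' v' :
  fdist (fadd u v) (fadd u' v') <= fdist u u' + fdist v v'.
Proof.
apply: fdist_le => a a01.
  by rewrite !lo_fadd// opprD addrACA (le_trans (ler_normD _ _))// lerD// lo_le_fdist.
by rewrite !hi_fadd// opprD addrACA (le_trans (ler_normD _ _))// lerD// hi_le_fdist.
Qed.

Lemma fdist_fscale k u v : 0 <= k ->
  fdist (fscale k u) (fscale k v) <= k * fdist u v.
Proof.
move=> k0; apply: fdist_le => a a01.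
  by rewrite !lo_fscale// -mulrBr normrM ger0_norm// ler_wpM2l// lo_le_fdist.
by rewrite !hi_fscale// -mulrBr normrM ger0_norm// ler_wpM2l// hi_le_fdist.
Qed.

Lemma fcvgP (u : nat -> fuzzy R) v :
  fcvg u v <-> forall e, 0 < e -> exists N, forall n, (N <= n)%N -> fdist (u n) v < e.
Proof.
split=> [uv e e0|uv].
  have [N _ uN] := cvgr0_norm_lt _ uv e e0.
  by exists N => n /uN; rewrite ger0_norm// fdist_ge0.
apply/cvgr0Pnorm_lt => e /uv[N uN].
by exists N => // n /uN; rewrite ger0_norm// fdist_ge0.
Qed.

Lemma fcvg_fscale k (u : nat -> fuzzy R) v : 0 <= k ->
  fcvg u v -> fcvg (fun n => fscale k (u n)) (fscale k v).
Proof.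
move=> k0 uv; have kuv : k * fdist (u n) v @[n --> \oo] --> (0 : R).
  by rewrite -[X in _ --> X](mulr0 k); exact: cvgMr.
apply: (squeeze_cvgr _ (cvg_cst 0) kuv).
by apply: nearW => n; rewrite fdist_ge0 fdist_fscale.
Qed.

Lemma fcvg_sum m (u : nat -> 'I_m -> fuzzy R) (v : 'I_m -> fuzzy R) :
  (forall i, fcvg (u^~ i) (v i)) -> fcvg (fun n => \sum_i u n i) (\sum_i v i).
Proof.
elim: m u v => [|m IHm] u v uv.
  rewrite /fcvg; under eq_fun do rewrite !big_ord0 fdistuu.
  exact: cvg_cst.
have sumuv : fcvg (fun n => \sum_i u n (lift ord0 i)) (\sum_i v (lift ord0 i)).
  by apply: (IHm (fun n i => u n (lift ord0 i))) => i; exact: uv.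
have uv' : fdist (u n ord0) (v ord0) +
    fdist (\sum_i u n (lift ord0 i)) (\sum_i v (lift ord0 i)) @[n --> \oo] --> (0 : R).
  by rewrite -[X in _ --> X]addr0; exact: cvgD (uv ord0) sumuv.
apply: (squeeze_cvgr _ (cvg_cst 0) uv').
by apply: nearW => n; rewrite fdist_ge0 !big_ord_recl fdist_fadd.
Qed.

(** Pointwise limits exist because the reals are complete; letting [m] tend to infinity in the
    non-strict bound keeps the same [N] for all [a]. Off [I] the value of [l] may be a default
    one. *)
Lemma uniform_cauchy_cvg (I : set R) (g : nat -> R -> R) :
  (forall e, 0 < e -> exists N, forall m n, (N <= m)%N -> (N <= n)%N ->
    forall a, I a -> `|g m a - g n a| <= e) ->
  exists l : R -> R, forall e, 0 < e -> exists N, forall n, (N <= n)%N ->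
    forall a, I a -> `|g n a - l a| <= e.
Proof.
move=> gC; exists (fun a => lim (g n a @[n --> \oo])) => e e0.
have [N gN] := gC _ e0; exists N => n Nn a Ia.
have cvg_ga : cvg (g n a @[n --> \oo]).
  apply: cauchy_cvg; apply: cauchy_exP => d d0.
  have [|M gM] := gC (d / 2); first by rewrite divr_gt0.
  exists (g M a); exists M => // p /= Mp; rewrite /ball /=.
  by rewrite (le_lt_trans (gM _ _ _ _ _ _))// ltr_pdivrMr// ltr_pMr// ltr1n.
have cvg_dist : `|g n a - g m a| @[m --> \oo] --> `|g n a - lim (g n a @[n --> \oo])|.
  by apply: cvg_norm; apply: cvgB => //; exact: cvg_cst.
apply: (closed_cvg (fun x => x <= e)) cvg_dist; first exact: closed_le.
by exists N => // m /= Nm; exact: gN.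
Qed.

(** The end points are Cauchy uniformly in the level, and uniform limits keep the order,
    monotonicity and one-sided continuity that [fuzzy_representation] asks for. *)
Lemma fuzzy_complete (u : nat -> fuzzy R) :
  (forall e, 0 < e -> exists N, forall m n, (N <= m)%N -> (N <= n)%N ->
    fdist (u m) (u n) <= e) ->
  exists v, fcvg u v.
Proof.
move=> uC; pose I : set R := [set a | 0 <= a <= 1].
have [|l ul] := @uniform_cauchy_cvg I (fun n a => lo (u n) a).
  move=> e /uC[N uN]; exists N => m n Nm Nn a Ia.
  by rewrite (le_trans (lo_le_fdist _ _ Ia)) ?uN.
have [|h uh] := @uniform_cauchy_cvg I (fun n a => hi (u n) a).
  move=> e /uC[N uN]; exists N => m n Nm Nn a Ia.
  by rewrite (le_trans (hi_le_fdist _ _ Ia)) ?uN.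
(* One index [n] serves both ends and every level, so properties of the ends of [u n] pass to [l]
   and [h] up to multiples of [e]. *)
have approx e : 0 < e -> exists n, forall a, I a ->
    (lo (u n) a - e <= l a <= lo (u n) a + e) /\
    (hi (u n) a - e <= h a <= hi (u n) a + e).
  move=> e0; have [N1 u1] := ul _ e0; have [N2 u2] := uh _ e0.
  exists (maxn N1 N2) => a Ia.
  have := u1 _ (leq_maxl N1 N2) a Ia; have := u2 _ (leq_maxr N1 N2) a Ia.
  by rewrite !ler_norml => /andP[? ?] /andP[? ?]; split; apply/andP; split; lra.
have I0 : I 0 by rewrite /I /= lexx ler01.
have I1 : I 1 by rewrite /I /= lexx ler01.
have II a b : 0 <= a -> a <= b -> b <= 1 -> I a /\ I b.
  by move=> a0 ab b1; rewrite /I /= a0 b1 (le_trans ab b1) (le_trans a0 ab).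
have l_mono a b : 0 <= a -> a <= b -> b <= 1 -> l a <= l b.
  move=> a0 ab b1; have [Ia Ib] := II _ _ a0 ab b1.
  apply/ler_addgt0Pr => e e0; have [|n un] := approx (e / 2); first by rewrite divr_gt0.
  have := lo_mono (u n) a0 ab b1.
  by have [/andP[? ?] _] := un _ Ia; have [/andP[? ?] _] := un _ Ib; lra.
have h_mono a b : 0 <= a -> a <= b -> b <= 1 -> h b <= h a.
  move=> a0 ab b1; have [Ia Ib] := II _ _ a0 ab b1.
  apply/ler_addgt0Pr => e e0; have [|n un] := approx (e / 2); first by rewrite divr_gt0.
  have := hi_mono (u n) a0 ab b1.
  by have [_ /andP[? ?]] := un _ Ia; have [_ /andP[? ?]] := un _ Ib; lra.
have l_le_h a : I a -> l a <= h a.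
  move=> Ia; apply/ler_addgt0Pr => e e0.
  have [|n un] := approx (e / 2); first by rewrite divr_gt0.
  by have := lo_le_hi (u n) Ia; have [/andP[? ?] /andP[? ?]] := un _ Ia; lra.
(* One third pays for the one-sided continuity of the ends of [u n], the other two for replacing [l]
   or [h] by these ends at the two levels compared. *)
have third e : 0 < e -> 0 < e / 3 by move=> e0; rewrite divr_gt0.
have oc_I a : 0 < a <= 1 -> I a by move=> /andP[a0 a1]; rewrite /I /= ltW.
have lt_I b a : 0 < b < a -> 0 < a <= 1 -> I b.
  by move=> /andP[b0 ba] /andP[_ a1]; rewrite /I /= ltW// (le_trans (ltW ba)).
have [|||||||v vE] := @fuzzy_representation R l h => //.
- exact: l_le_h.
- move=> a e a01 /third e0; have [n un] := approx _ e0.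
  have [b ba H] := lo_leftC (u n) a01 e0; exists b => //.
  have [/andP[? ?] _] := un _ (oc_I _ a01).
  by have [/andP[? ?] _] := un _ (lt_I _ _ ba a01); lra.
- move=> a e a01 /third e0; have [n un] := approx _ e0.
  have [b ba H] := hi_leftC (u n) a01 e0; exists b => //.
  have [_ /andP[? ?]] := un _ (oc_I _ a01).
  by have [_ /andP[? ?]] := un _ (lt_I _ _ ba a01); lra.
- move=> e /third e0; have [n un] := approx _ e0.
  have [b b01 H] := lo_right0 (u n) e0; exists b => //.
  have [/andP[? ?] _] := un _ I0.
  by have [/andP[? ?] _] := un _ (oc_I _ b01); lra.
- move=> e /third e0; have [n un] := approx _ e0.
  have [b b01 H] := hi_right0 (u n) e0; exists b => //.
  have [_ /andP[? ?]] := un _ I0.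
  by have [_ /andP[? ?]] := un _ (oc_I _ b01); lra.
exists v; apply/fcvgP => e e0; have e2 : 0 < e / 2 by rewrite divr_gt0.
have [N1 u1] := ul _ e2; have [N2 u2] := uh _ e2.
exists (maxn N1 N2) => n; rewrite geq_max => /andP[N1n N2n].
(* The supremum inherits only a non-strict bound; the halving restores strictness. *)
apply: (@le_lt_trans _ _ (e / 2)); last by lra.
have vlh a (Ia : I a) := lo_hi_unique Ia (l_le_h _ Ia) (vE _ Ia).
by apply: fdist_le => a Ia; have [loE hiE] := vlh _ Ia; rewrite ?loE ?hiE;
  [exact: u1|exact: u2].
Qed.

End fuzzy_metric.

(** * Fine divisions on a time scale and Cousin's lemma *)

Section divisions.
Context {R : realType} (T : set R).
Implicit Types (a b x y t : R) (d : (R -> R) * (R -> R)) (D : division R).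

Lemma fine_division_rcons a x y t d D : fine_division T a x d D ->
  T y -> x < y -> ts_itv T x y t -> t - d.1 t <= x -> y <= t + d.2 t ->
  exists D', fine_division T a y d D'.
Proof.
move=> [pt0 ptx ptT ptD] Ty xy xty tx yt.
(* At [i = dsize D] the point is still the old last one, [x], which is the left end of the new
   interval. *)
exists (Division (dsize D).+1 (fun i => if (i <= dsize D)%N then pt D i else y)
  (fun i => if (i < dsize D)%N then Defs.tag D i else t)).
split=> //=; first by rewrite ltnn.
  by move=> i _; case: ifP => // /ptT.
move=> i; rewrite ltnS => iD; rewrite iD.
have [/ptD//|Di] := ltnP i (dsize D).
have -> : i = dsize D by apply/eqP; rewrite eqn_leq iD.
by rewrite ptx.
Qed.

Lemma fine_division_bounds a b d D i : fine_division T a b d D ->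
  (i <= dsize D)%N -> a <= pt D i <= b.
Proof.
move=> [pt0 ptb _ ptD] iD.
have incr j k : (j + k <= dsize D)%N -> pt D j <= pt D (j + k).
  elim: k => [|k IHk]; first by rewrite addn0.
  rewrite addnS => jkD; apply: le_trans (IHk (ltnW jkD)) _.
  by have [/ltW] := ptD _ jkD.
rewrite -{1}pt0 -ptb -(subnKC iD) incr ?subnKC// andbT.
exact: (incr 0%N).
Qed.

Lemma fine_division_tag a b d D i : fine_division T a b d D ->
  (i < dsize D)%N -> ts_itv T a b (Defs.tag D i).
Proof.
move=> fD iD; have [_ _ _ /(_ _ iD)[_ [Tt /andP[lt th]] _ _]] := fD.
have /andP[al _] := fine_division_bounds fD (ltnW iD).
have /andP[_ hb] := fine_division_bounds fD iD.
by split=> //; rewrite (le_trans al) ?(le_trans th).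
Qed.

(* If [x] is right-scattered within reach of the gauge, the next point is
   [ts_sigma T x]: this is where the condition [ts_mu <= d.2] is used. *)
Lemma gauge_step a b x d : closed T -> T b -> gauge T a b d ->
  T x -> a <= x < b -> exists2 y, T y & x < y <= b /\ y <= x + d.2 x.
Proof.
move=> Tcl Tb [_ dR _ _ dmu] Tx axb; have /andP[ax xb] := axb.
pose A := [set y | T y /\ x < y].
have Ab : A b by [].
have Ainf : has_inf A by split; [exists b|exists x => y [_ /ltW]].
have sigmaE : ts_sigma T x = inf A.
  by rewrite /ts_sigma ifF//; apply/negP => /eqP A0; have := Ab; rewrite /A A0.
have infb : inf A <= b by apply: ge_inf => //; exact: Ainf.2.
have infx : inf A <= x + d.2 x by have := dmu _ Tx axb; rewrite /ts_mu sigmaE lerBlDl.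
(* In the first case a point of [A] lies within reach, and is replaced by [b] if it exceeds [b].
   Otherwise [inf A] is strictly right of [x], and it belongs to [T] by closedness. *)
have [inflt|infge] := ltP (inf A) (x + d.2 x).
  have [y [Ty xy] yd] := inf_adherent (etrans (subr_gt0 _ _) inflt) Ainf.
  move: yd; rewrite addrC subrK => yd.
  have [yb|/ltW by_] := leP y b; first by exists y => //; rewrite xy yb ltW.
  by exists b => //; rewrite xb lexx (le_trans by_) ?ltW.
exists (inf A); last first.
  by rewrite infb infx andbT; split=> //; rewrite (lt_le_trans _ infge)// ltrDl dR.
rewrite (closure_id T).1//; apply: near_closure => e e0.
have [y Ay ye] := inf_adherent e0 Ainf; exists y; first by case: Ay.
rewrite ltr_distlC ye andbT (lt_le_trans (y := inf A))//; first by rewrite ltrBlDr ltrDl.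
by apply: ge_inf => //; exact: Ainf.2.
Qed.

(** The supremum [c] of the points reachable from [a] is reached, if necessary by a last interval
    tagged at [c]; were [c < b], a further interval tagged at [c] would lead beyond it. *)
Lemma fine_division_exists a b d : closed T -> T a -> T b -> a < b ->
  gauge T a b d -> exists D, fine_division T a b d D.
Proof.
move=> Tcl Ta Tb ab gd; have [dL dR dLa dRb dmu] := gd.
pose S := [set x | [/\ T x, a <= x <= b & exists D, fine_division T a x d D]].
have Sa : S a.
  split=> //; first by rewrite lexx ltW.
  (* The division with no interval starts the argument. *)
  by exists (Division 0 (fun=> a) (fun=> a)).
have Ssup : has_sup S by split; [exists a|exists b => x [_ /andP[]]].
pose c := sup S.
have ac : a <= c by apply: ub_le_sup => //; exact: Ssup.2.
have cb : c <= b by apply: ge_sup; [exact: Ssup.1|move=> x [_ /andP[]]].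
have Tc : T c.
  rewrite (closure_id T).1//; have := closure_sup Ssup.1 Ssup.2.
  by apply: closureS => x [].
(* A gauge may vanish on the left at [a] and on the right at [b]; nonnegativity is enough on the
   side where the tag [c] is an end of its interval. *)
have dLc : 0 <= d.1 c.
  by move: ac; rewrite le_eqVlt => /predU1P[<-//|ac]; rewrite ltW// dL// ac.
have dRc : 0 <= d.2 c.
  by move: cb; rewrite le_eqVlt => /predU1P[->//|cb]; rewrite ltW// dR// ac.
have Sc : S c.
  have [<-//|anc] := eqVneq a c.
  have dLc0 : 0 < d.1 c by apply: dL => //; rewrite lt_neqAle anc ac.
  (* A reachable [s] lies less than [d.1 c] below [c], so [c] can tag the interval from [s] to
     [c]. *)
  have [s Ss sc] := sup_adherent dLc0 Ssup; have [Ts _ [D fD]] := Ss.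
  have : s <= c by apply: ub_le_sup => //; exact: Ssup.2.
  rewrite le_eqVlt => /predU1P[<-//|ltsc]; split=> //; first by rewrite ac.
  by apply: (fine_division_rcons (t := c) fD);
    rewrite ?lerDl//; [split; rewrite ?lexx ?ltW|exact: ltW].
have [_ _ [D fD]] := Sc.
move: cb; rewrite le_eqVlt => /predU1P[<-|cb]; first by exists D.
have [|y Ty [/andP[cy yb] yd]] := gauge_step Tcl Tb gd Tc; first by rewrite ac.
suff : y <= c by rewrite leNgt cy.
apply: ub_le_sup; first exact: Ssup.2.
split=> //; first by rewrite yb (le_trans ac)// ltW.
by apply: (fine_division_rcons (t := c) fD);
  rewrite ?gerBl//; split; rewrite ?lexx ?ltW.
Qed.

(** The lower bound [ts_mu] survives the minimum because both right components obey it. *)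
Lemma gauge_min a b d d' : gauge T a b d -> gauge T a b d' ->
  gauge T a b (d.1 \min d'.1, d.2 \min d'.2).
Proof.
move=> [dL dR dLa dRb dmu] [dL' dR' dLa' dRb' dmu'].
split=> [x Tx xab|x Tx xab|||x Tx xab] /=.
- by rewrite lt_min dL ?dL'.
- by rewrite lt_min dR ?dR'.
- by rewrite le_min dLa.
- by rewrite le_min dRb.
- by rewrite le_min dmu ?dmu'.
Qed.

Lemma fine_division_le a b d d' D :
  (forall x, d.1 x <= d'.1 x) -> (forall x, d.2 x <= d'.2 x) ->
  fine_division T a b d D -> fine_division T a b d' D.
Proof.
move=> d1 d2 [pt0 ptb ptT ptD]; split=> // i /ptD[? ? tl tr]; split=> //.
  by rewrite (le_trans _ tl)// lerB.
by rewrite (le_trans tr)// lerD.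
Qed.

End divisions.

(** * Uniqueness of the integral and convergence of Riemann sums *)

Section integral.
Context {R : realType} (T : set R) (a b : R).
Context (Tcl : closed T) (Ta : T a) (Tb : T b) (ab : a < b).
Implicit Types (f : R -> fuzzy R) (A : fuzzy R).

(** A single division, fine for the minimum of two gauges, has a Riemann sum close to both
    candidates. *)
Lemma is_FHK_unique f A A' : is_FHK T a b f A -> is_FHK T a b f A' -> A = A'.
Proof.
move=> fA fA'; apply: fdist_eq0; apply/ler_addgt0Pr => e e0; rewrite add0r.
have e2 : 0 < e / 2 by rewrite divr_gt0.
have [d gd dA] := fA _ e2; have [d' gd' dA'] := fA' _ e2.
have [D fD] := fine_division_exists Tcl Ta Tb ab (gauge_min gd gd').
have {}/dA DA : fine_division T a b d D.
  by apply: fine_division_le fD => x /=; rewrite ge_min lexx.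
have {}/dA' DA' : fine_division T a b d' D.
  by apply: fine_division_le fD => x /=; rewrite ge_min lexx orbT.
apply: le_trans (fdist_triangle (riemann_sum f D) _ _) _.
by rewrite fdistC; lra.
Qed.

(** [FHK_int] chooses some integral; uniqueness forces the choice. *)
Lemma FHK_intE f A : is_FHK T a b f A -> FHK_int T a b f = A.
Proof.
move=> fA; apply: (is_FHK_unique _ fA).
exact: (xgetPex 0 (ex_intro (is_FHK T a b f) A fA)).
Qed.

(** A fixed [D] has finitely many tags, all in [[a, b]_T], so pointwise convergence suffices. *)
Lemma fcvg_riemann_sum (F : nat -> R -> fuzzy R) f d (D : division R) :
  (forall x, ts_itv T a b x -> fcvg (fun n => F n x) (f x)) ->
  fine_division T a b d D ->
  fcvg (fun n => riemann_sum (F n) D) (riemann_sum f D).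
Proof.
move=> Ff fD; apply: (fcvg_sum (u := fun n i =>
  fscale (pt D i.+1 - pt D i) (F n (Defs.tag D i)))) => i.
apply: fcvg_fscale; last by apply/Ff/(fine_division_tag fD).
by have [_ _ _ /(_ _ (ltn_ord i))[/ltW]] := fD; rewrite subr_ge0.
Qed.

End integral.

Theorem theorem8 (R : realType) (T : set R) (a b : R)
    (F : nat -> R -> fuzzy R) (f : R -> fuzzy R) :
  time_scale T -> T a -> T b -> a < b ->
  (forall n, FHK_integrable T a b (F n)) ->
  (forall x, ts_itv T a b x -> fcvg (fun n => F n x) (f x)) ->
  uniformly_FHK T a b F ->
  FHK_integrable T a b f /\
  fcvg (fun n => FHK_int T a b (F n)) (FHK_int T a b f).
Proof.
move=> [_ Tcl] Ta Tb ab _ Ff [_ unifF].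
have [A FA] : exists A, fcvg (fun n => FHK_int T a b (F n)) A.
  (* Four quarters: from the integral of [F m] to its sum over [D], to the sum of [f], to the sum of
     [F n], to the integral of [F n]. *)
  apply: fuzzy_complete => e e0; have e4 : 0 < e / 4 by rewrite divr_gt0.
  have [d gd dF] := unifF _ e4.
  have [D fD] := fine_division_exists Tcl Ta Tb ab gd.
  have [N DN] := (fcvgP _ _).1 (fcvg_riemann_sum Ff fD) _ e4.
  exists N => m n /DN Dm /DN Dn.
  have near_f p : fdist (riemann_sum (F p) D) (riemann_sum f D) < e / 4 ->
      fdist (FHK_int T a b (F p)) (riemann_sum f D) <= e / 2.
    move=> /ltW Dp; have -> : e / 2 = e / 4 + e / 4 by lra.
    apply: le_trans (fdist_triangle (riemann_sum (F p) D) _ _) (lerD _ Dp).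
    by rewrite fdistC; exact/ltW/dF.
  rewrite [e]splitr; apply: le_trans (fdist_triangle (riemann_sum f D) _ _) _.
  by apply: lerD; [|rewrite fdistC]; exact: near_f.
have fA : is_FHK T a b f A.
  move=> e e0; have e3 : 0 < e / 3 by rewrite divr_gt0.
  (* The gauge is fixed before [D], while the index [n] below may depend on [D], since the estimate
     [dF] holds for every index. *)
  have [d gd dF] := unifF _ e3; exists d => // D fD.
  have [N1 DN] := (fcvgP _ _).1 (fcvg_riemann_sum Ff fD) _ e3.
  have [N2 AN] := (fcvgP _ _).1 FA _ e3.
  set n := maxn N1 N2.
  apply: le_lt_trans (fdist_triangle (riemann_sum (F n) D) _ _) _.
  have -> : e = e / 3 + (e / 3 + e / 3) by lra.
  apply: ltrD; first by rewrite fdistC; apply: DN; exact: leq_maxl.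
  apply: le_lt_trans (fdist_triangle (FHK_int T a b (F n)) _ _) _.
  by apply: ltrD; [exact: dF|apply: AN; exact: leq_maxr].
by split; [exists A|rewrite (FHK_intE Tcl Ta Tb ab fA)].
Qed.
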